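(* For every integer $k \geq 2$, \[ \frac{n^2 - (1+o(1))n^{3/2}}{k} \leq S_\ell(n, k) \leq 28\, n \log_2 n \cdot \left\lceil\frac{n-1}{k-1}\right\rceil, \] where $o(1)$ denotes a quantity tending to $0$ as $n \to \infty$.
   Context: Permutation Mastermind on $n \geq 2$: a secret $\sigma^\star \in S_n$ is chosen; a guess $\pi \in S_n$ receives the black-peg score $b(\pi,\sigma^\star) := |\{i \in [n] : \pi(i) = \sigma^\star(i)\}|$. A static strategy is a fixed list of guesses $(\pi_1,\dots,\pi_T)$ announced in advance; the codemaker then reveals $b(\pi_1,\sigma^\star),\dots,b(\pi_T,\sigma^\star)$, after which the codebreaker makes one final guess, which must equal $\sigma^\star$ for the strategy to be correct (for every $\sigma^\star$). For $\pi,\sigma\in S_n$ let $D(\pi,\sigma) := \{i : \pi(i)\neq\sigma(i)\}$. The static strategy is $\ell_k$-local if $|D(\pi_t,\pi_{t+1})| \leq k$ for all $1\le t<T$; the final guess is not subject to this restriction. $S_\ell(n,k)$ is the minimum length $T$ of the list of a correct $\ell_k$-local static strategy. *)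

(* Defs.v *)
From mathcomp Require Import all_boot all_order all_fingroup all_algebra.
From mathcomp Require Import boolp reals topology normedtype exp.

Set Implicit Arguments.
Unset Strict Implicit.
Unset Printing Implicit Defensive.

Import Order.TTheory GRing.Theory Num.Theory.

Definition black (n : nat) (p s : 'S_n) : nat := #|[set i | p i == s i]|.

Definition diffset (n : nat) (p s : 'S_n) : {set 'I_n} := [set i | p i != s i].

(* [g] is the list of guesses fixed in advance; [final] is the codebreaker's
   last guess, which may depend only on the revealed scores. *)
Definition correct_static (n : nat) (g : seq 'S_n) : Prop :=
  exists final : seq nat -> 'S_n,
    forall secret : 'S_n, final [seq black p secret | p <- g] = secret.

Definition local_step (n k : nat) : rel 'S_n :=
  fun p q => (#|diffset p q| <= k)%N.

(* The final guess is not part of [g], hence not subject to locality. *)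
Definition ell_local (n k : nat) (g : seq 'S_n) : bool :=
  sorted (@local_step n k) g.

Definition local_static_length (n k T : nat) : Prop :=
  exists g : seq 'S_n, [/\ size g = T, ell_local k g & correct_static g].

Lemma local_step_path (n k : nat) (p q : 'S_n) : (1 < k)%N ->
  exists2 w, path (@local_step n k) p w & last p w = q.
Proof.
move=> k_gt1.
have [ts tsE _] := prod_tpermP (q * p^-1)%g.
have -> : q = ((\prod_(t <- ts) tperm t.1 t.2) * p)%g by rewrite -tsE mulgKV.
elim: ts {tsE} => [|t ts [w pw lw]].
  by exists [::]; rewrite //= big_nil mul1g.
set r := (_ * p)%g in lw.
exists (rcons w (tperm t.1 t.2 * r)%g); last first.
  by rewrite last_rcons big_cons -mulgA.
rewrite rcons_path pw lw /local_step /=.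
apply: leq_trans k_gt1; apply: (@leq_trans #|[set t.1; t.2]|).
  apply: subset_leq_card; apply/subsetP=> i; rewrite !inE permM.
  by apply: contraR; case: tpermP => // ->; rewrite eqxx ?orbT.
by rewrite cards2; case: (_ != _).
Qed.

Lemma local_static_exists (n k : nat) : (1 < k)%N ->
  exists T, `[< local_static_length n k T >].
Proof.
move=> k_gt1.
have [w pw allw] : exists2 w, path (@local_step n k) 1%g w &
    {subset enum {perm 'I_n} <= w}.
  elim: (enum _) (1%g : 'S_n) => [|q s IHs] p; first by exists [::].
  have [w2 pw2 sw2] := IHs q.
  have [[|x w1] pw1 lw1] := local_step_path p q k_gt1.
    rewrite /= in lw1; exists (p :: w2).
      rewrite /= /local_step; apply/andP; split; last by rewrite lw1.
      rewrite (_ : diffset p p = set0) ?cards0 //.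
      by apply/setP=> i; rewrite !inE eqxx.
    move=> y; rewrite !inE lw1 => /orP[->//|/sw2->]; exact: orbT.
  exists ((x :: w1) ++ w2); first by rewrite cat_path pw1 lw1.
  move=> y; rewrite inE mem_cat => /orP[/eqP->|/sw2->]; last exact: orbT.
  by rewrite -lw1 /= mem_last.
exists (size w); apply/asboolP; exists w; split=> //.
  exact: path_sorted pw.
pose score s := [seq black p s | p <- w].
have score_inj : injective score.
  move=> s s' /eq_in_map eqs; apply/permP=> i.
  have sw : s \in w by apply: allw; rewrite mem_enum.
  have := eqs _ sw; rewrite /black => e.
  have sT : [set j | s j == s j] = setT.
    by apply/setP=> j; rewrite !inE eqxx.
  move: e; rewrite sT => e.
  have /eqP sT' : [set j | s j == s' j] == setT.
    by rewrite eqEcard subsetT -e leqnn.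
  by move/setP/(_ i): sT'; rewrite !inE => /eqP.
exists (fun v => odflt 1%g [pick s | score s == v]) => s.
case: pickP => [s' /eqP /score_inj//|/(_ s)]; by rewrite eqxx.
Qed.

(* S_l(n, k); [k_gt1] is only used to know that some correct l_k-local
   strategy exists. *)
Definition S_ell (n k : nat) (k_gt1 : (1 < k)%N) : nat :=
  ex_minn (local_static_exists n k_gt1).

Definition log2 (R : realType) (x : R) : R := (ln x / ln 2)%R.

(* Main.v *)
(* Lower bound: a local list of T guesses covers at most n + k T cells (i, p i).
   If the uncovered cells contained a rectangle, two secrets differing by the swap
   it carries would receive the same scores; hence they form a C4-free bipartite
   graph and number at most n^(3/2) + n.

   Upper bound: let s, s' be secrets at distance d and rho = s s'^-1. If a guess p
   satisfies p i = s i or p (rho i) = s i, swapping its values at i and rho i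
   exchanges a hit of s with a hit of s', so at most one of the two guesses gives
   s and s' equal scores. Choosing i in a set A of at least d/3 points moved by rho
   with A and rho A disjoint, such a swap is available with probability at least
   |A|/n (Bonferroni), so a uniform guess separates s from s' with probability at
   least d/(6n). By a union bound 28 n log2 n independent guesses separate all the
   secrets, and any two permutations are joined by a walk of at most
   ceil((n-1)/(k-1)) steps, each changing at most k values. *)

Require Import Defs.
From mathcomp Require Import all_boot all_order all_fingroup all_algebra.
From mathcomp Require Import zify ring lra.

Import Order.TTheory GRing.Theory Num.Theory.

Set Implicit Arguments.
Unset Strict Implicit.
Unset Printing Implicit Defensive.

(** * Balanced guesses *)

Definition balanced n (s s' : 'S_n) : {set 'S_n} :=
  [set p | black p s == black p s'].

Lemma diffset0_eq n (p q : 'S_n) : diffset p q = set0 -> p = q.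
Proof.
by move=> e; apply/permP=> i; apply/eqP; have/setP/(_ i) := e; rewrite !inE => /negbFE.
Qed.

(** Right multiplication by [tperm b b'] exchanges the values [b] and [b'], so it carries the fibre
    over [b] into the fibre over [b']: all fibres over [V] have the same size. *)
Lemma card_perm_fiber n (A : {set 'S_n}) (i b : 'I_n) (V : {set 'I_n}) :
  {in A, forall p : 'S_n, p i \in V} ->
  {in V &, forall b b', forall p, p \in A -> (p * tperm b b')%g \in A} ->
  b \in V -> (#|V| * #|[set p in A | p i == b]| = #|A|)%N.
Proof.
move=> AV AM bV.
have le c c' : c \in V -> c' \in V ->
    (#|[set p in A | p i == c]| <= #|[set p in A | p i == c']|)%N.
  move=> cV c'V; rewrite -(card_imset _ (mulIg (tperm c c'))).
  apply/subset_leq_card/subsetP=> _ /imsetP[p + ->].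
  by rewrite !inE => /andP[pA /eqP pc]; rewrite AM //= permM pc tpermL.
have -> : #|A| = (\sum_(c in V) #|[set p in A | p i == c]|)%N.
  rewrite -sum1_card (partition_big (fun p : 'S_n => p i) (mem V)) //=.
  apply: eq_bigr => c _; rewrite -sum1_card.
  by apply: eq_bigl => p; rewrite inE.
rewrite -sum_nat_const; apply: eq_bigr => c cV.
by apply/eqP; rewrite eqn_leq !le.
Qed.

Lemma card_perm1 n (i a : 'I_n) : (n * #|[set p : 'S_n | p i == a]| = n`!)%N.
Proof.
have := @card_perm_fiber n setT i a setT.
rewrite cardsT card_ord cardsT card_Sn => <- //; try by move=> *; rewrite inE.
by congr (_ * #|pred_of_set _|)%N; apply/setP=> p; rewrite !inE.
Qed.

Lemma card_perm2 n (i j a b : 'I_n) : i != j ->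
  (n * n.-1 * #|[set p : 'S_n | (p i == a) && (p j == b)]| <= n`!)%N.
Proof.
move=> ij; have [<-|ab] := eqVneq a b.
  rewrite (_ : [set _ | _] = set0) ?cards0 ?muln0 //.
  apply/setP=> p; rewrite !inE; apply/negbTE/negP => /andP[/eqP <-].
  by rewrite (inj_eq perm_inj) eq_sym (negbTE ij).
rewrite -(card_perm1 i a) -mulnA leq_mul2l orbC.
rewrite -(@card_perm_fiber n [set p : 'S_n | p i == a] j b [set~ a]); first last.
- by rewrite !inE eq_sym.
- move=> c c'; rewrite !inE => ca c'a p; rewrite !inE => /eqP pa.
  by rewrite permM pa tpermD.
- by move=> p; rewrite !inE => /eqP <-; rewrite (inj_eq perm_inj) eq_sym.
rewrite cardsC1 card_ord leq_mul2l subset_leq_card ?orbT //.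
by apply/subsetP=> p; rewrite !inE.
Qed.

(** * Probability that a uniform guess separates two secrets *)

Section Separation.
Variables (n : nat) (s s' : 'S_n).

Let rho : 'S_n := (s * s'^-1)%g.

Let s'rho i : s' (rho i) = s i. Proof. by rewrite permM permKV. Qed.

Let rho_diff i : (i \in diffset s s') = (rho i != i).
Proof. by rewrite inE -s'rho (inj_eq perm_inj). Qed.

(** The value [s i] scores for [s] at [i] and for [s'] at [rho i]; asking for either position makes
    the condition invariant under the flip at [i]. *)
Let hit (i : 'I_n) (p : 'S_n) := (p i == s i) || (p (rho i) == s i).

(** The flip moves the value [s i] from [i] to [rho i], where only [s'] wants it. Neither position
    gave [s'] a peg before, and neither gives [s] one afterwards, so both inclusions of peg sets are
    strict. *)
Let flip_unbalanced_wlog i (p : 'S_n) : i \in diffset s s' -> p i = s i ->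
  (black (tperm i (rho i) * p)%g s < black p s)%N /\
  (black p s' < black (tperm i (rho i) * p)%g s')%N.
Proof.
move=> iD pi; have rhoi : rho i != i by rewrite -rho_diff.
split; apply/proper_card/properP; split.
- apply/subsetP=> l; rewrite !inE permM; case: tpermP => [->|->|//].
    by rewrite -pi (inj_eq perm_inj) (negbTE rhoi).
  by rewrite pi (inj_eq perm_inj) eq_sym (negbTE rhoi).
- exists i; rewrite !inE -pi ?eqxx //.
  by rewrite permM tpermL (inj_eq perm_inj).
- apply/subsetP=> l; rewrite !inE permM; case: tpermP => [->|->|//].
    by rewrite pi -s'rho (inj_eq perm_inj) (negbTE rhoi).
  by rewrite s'rho -pi (inj_eq perm_inj) (negbTE rhoi).
- exists (rho i); rewrite !inE s'rho -pi ?(inj_eq perm_inj) //.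
  by rewrite permM tpermR.
Qed.

(* The flip exchanges a black peg for [s] with a black peg for [s'], so it
   cannot preserve the equality of the two scores. *)
Lemma flip_unbalanced i (p : 'S_n) : i \in diffset s s' -> hit i p ->
  p \in balanced s s' -> (tperm i (rho i) * p)%g \notin balanced s s'.
Proof.
move=> iD /orP[] /eqP hi; rewrite !inE => /eqP eb.
  have [h1 h2] := flip_unbalanced_wlog iD hi.
  by apply/eqP=> e; move: h1 h2; rewrite e eb => /ltn_trans h /h; rewrite ltnn.
(* When the value sits at [rho i], the flipped guess has it at [i]; the flip is undone by applying
   it again. *)
have := @flip_unbalanced_wlog i (tperm i (rho i) * p)%g iD.
rewrite permM tpermL => /(_ hi) []; rewrite mulgA tperm2 mul1g eb => h1 h2.
by apply/eqP=> e; move: h2 h1; rewrite e => /ltn_trans h /h; rewrite ltnn.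
Qed.

(** The pairs [{i, rho i}] for [i] in such a set are pairwise disjoint, so flips at different points
    do not interfere. *)
Let indep (A : {set 'I_n}) :=
  (A \subset diffset s s') && [disjoint A & rho @: A].

(** A maximal set works: a moved point outside [A], its image and its preimage under [rho] could be
    added to [A]. *)
Let indep_exists : exists A : {set 'I_n}, [/\ A \subset diffset s s', [disjoint A & rho @: A],
  (#|diffset s s'| <= 3 * #|A|)%N & (2 * #|A| <= n)%N].
Proof.
have [|A /maxsetP[/andP[AD Adis] Amax] _] := @maxset_exists _ indep set0.
  by rewrite /indep sub0set disjoints_subset sub0set.
have cr (B : {set 'I_n}) : #|rho @: B| = #|B| by apply/card_imset/perm_inj.
exists A; split => //; last first.
  have := max_card (mem (A :|: rho @: A)); rewrite card_ord cardsU cr.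
  rewrite disjoint_sym in Adis.
  by rewrite setIC (eqP (_ : _ :&: _ == set0)) ?setI_eq0 // cards0; lia.
have -> : (3 * #|A| = #|A| + #|rho @: A| + #|rho^-1%g @: A|)%N.
  by rewrite cr card_imset; [lia|exact: perm_inj].
apply: (@leq_trans #|A :|: rho @: A :|: rho^-1%g @: A|); last first.
  by rewrite (leq_trans (leq_card_setU _ _)) // leq_add2r leq_card_setU.
apply/subset_leq_card/subsetP => x xD; rewrite !inE.
apply/negPn/negP; rewrite !negb_or => /andP[/andP[xA xrA] xr'A].
have AU : indep (x |: A).
  rewrite /indep subUset sub1set xD AD /=.
  apply/pred0P => y /=; rewrite !inE; apply/negP=> /andP[yA /imsetP[z]].
  rewrite !inE => /orP[/eqP ->|zA] yz; move: yA; rewrite yz => /orP[].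
  - by rewrite (negbTE (_ : rho x != x)) // -rho_diff.
  - by move=> rxA; rewrite -(permK rho x) imset_f in xr'A.
  - by move=> /eqP zx; rewrite -zx imset_f in xrA.
  - by move=> rzA; have := disjointFr Adis rzA; rewrite imset_f.
by move: xA; rewrite -(Amax _ AU) ?subsetUr ?setU11.
Qed.

Let hitE i p : i \in diffset s s' ->
  hit i p = ((p i == s i) + (p (rho i) == s i))%N :> nat.
Proof.
rewrite rho_diff /hit => rhoi; case: eqP => //= <-.
by rewrite (inj_eq perm_inj) (negbTE rhoi).
Qed.

Let sum_fiber (i a : 'I_n) :
  (\sum_(p : 'S_n) (p i == a) = #|[set p : 'S_n | p i == a]|)%N.
Proof. by rewrite -sum1_card [RHS]big_mkcond; apply: eq_bigr => p _; rewrite inE; case: ifP. Qed.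

Let sum_fiber2 (i j a b : 'I_n) : i != j ->
  (n * n.-1 * (\sum_(p : 'S_n) (p i == a) * (p j == b)) <= n`!)%N.
Proof.
move=> ij; apply: leq_trans (card_perm2 a b ij).
rewrite leq_mul2l -sum1_card [leqRHS]big_mkcond /= leq_sum ?orbT // => p _.
by rewrite inE mulnb; case: ifP.
Qed.

Let sum_hit i : i \in diffset s s' -> (n * (\sum_p hit i p) = 2 * n`!)%N.
Proof.
move=> iD; under eq_bigr do rewrite hitE //.
by rewrite big_split /= !sum_fiber mulnDr !card_perm1 mul2n addnn.
Qed.

Section Independent.
Variable A : {set 'I_n}.
Hypotheses (AD : A \subset diffset s s') (Adis : [disjoint A & rho @: A]).

Let rho_neq i j : i \in A -> j \in A -> rho i != j.
Proof.
by move=> iA jA; apply/eqP=> e; have := disjointFr Adis jA; rewrite -e imset_f.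
Qed.

Let sum_hit2 i j : i \in A -> j \in A -> i != j ->
  (n * n.-1 * (\sum_p hit i p * hit j p) <= 4 * n`!)%N.
Proof.
move=> iA jA ij.
have iD := subsetP AD _ iA; have jD := subsetP AD _ jA.
under eq_bigr do rewrite !hitE // mulnDl !mulnDr.
rewrite !big_split /= !mulnDr.
have h1 := sum_fiber2 (s i) (s j) ij.
have h2 : (n * n.-1 * (\sum_(p : 'S_n) (p i == s i) * (p (rho j) == s j)) <= n`!)%N.
  by apply: sum_fiber2; rewrite eq_sym rho_neq.
have h3 : (n * n.-1 * (\sum_(p : 'S_n) (p (rho i) == s i) * (p j == s j)) <= n`!)%N.
  by apply: sum_fiber2; rewrite rho_neq.
have h4 : (n * n.-1 * (\sum_(p : 'S_n) (p (rho i) == s i) * (p (rho j) == s j)) <= n`!)%N.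
  by apply: sum_fiber2; rewrite (inj_eq perm_inj).
by rewrite (_ : 4 * n`! = n`! + n`! + (n`! + n`!))%N ?leq_add //; lia.
Qed.

Let hitters : {set 'S_n} := [set p | [exists i in A, hit i p]].

(* Second Bonferroni inequality, through [3 x <= x ^ 2 + 2 [x > 0]]. *)
Lemma card_hitters : (2 * #|A| <= n)%N -> (#|A| * n`! <= n * #|hitters|)%N.
Proof.
move=> An; pose X p := (\sum_(i in A) hit i p)%N.
have pt p : (3 * X p <= X p * X p + 2 * (p \in hitters))%N.
  have [pG|pG] := boolP (p \in hitters); first by rewrite /=; move: (X p) => [|[|x]] //; nia.
  suff -> : X p = 0%N by [].
  apply: big1 => i iA; apply/eqP; rewrite eqb0; apply: contra pG => hi.
  by rewrite inE; apply/existsP; exists i; rewrite iA.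
have sG : (\sum_(p : 'S_n) (p \in hitters) = #|hitters|)%N.
  by rewrite -sum1_card [RHS]big_mkcond; apply: eq_bigr => p _; case: ifP.
have s1 : (n * \sum_p X p = 2 * #|A| * n`!)%N.
  rewrite exchange_big big_distrr /= (eq_bigr (fun=> 2 * n`!))%N.
    by rewrite sum_nat_const mulnCA mulnA.
  by move=> i iA; rewrite sum_hit // (subsetP AD).
have s2 : (n * n.-1 * \sum_p X p * X p <=
    #|A| * (n.-1 * (2 * n`!) + #|A|.-1 * (4 * n`!)))%N.
  under eq_bigr do rewrite big_distrlr /=.
  rewrite exchange_big big_distrr /= -sum_nat_const leq_sum // => i iA.
  rewrite exchange_big big_distrr (bigD1 i) //= leq_add //.
    rewrite -(sum_hit (subsetP AD _ iA)) mulnCA mulnA leq_mul2l.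
    by rewrite leq_sum ?orbT // => p _; case: hit.
  have -> : (#|A|.-1 * (4 * n`!) = \sum_(j in A | j != i) 4 * n`!)%N.
    rewrite sum_nat_const (cardD1 i A) iA /=; congr (_ * _)%N.
    by apply: eq_card => j; rewrite !inE andbC.
  by apply: leq_sum => j /andP[jA ij]; apply: sum_hit2; rewrite // eq_sym.
have s3 : (3 * \sum_p X p <= \sum_p X p * X p + 2 * #|hitters|)%N.
  by rewrite -sG !big_distrr -big_split leq_sum.
case: (posnP #|A|) => [->|A0]; first by rewrite mul0n.
have n1 : (0 < n.-1)%N by lia.
rewrite -(leq_pmul2l n1).
have s4 := leq_mul (leqnn (n * n.-1)) s3.
have s5 : (3 * (n.-1 * (2 * #|A| * n`!)) <=
    #|A| * (n.-1 * (2 * n`!) + #|A|.-1 * (4 * n`!)) + 2 * (n.-1 * (n * #|hitters|)))%N.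
  by rewrite -s1; lia.
(* Since [2 * #|A| <= n], the pairs [i != j] cost at most half of the main term. *)
have s6 : (#|A| * n`! * (2 * #|A|.-1) <= #|A| * n`! * n.-1)%N.
  by rewrite leq_mul2l; lia.
move: s5 s6; move: n.-1 #|A|.-1 #|A| (n`!) #|hitters| => n' a' a F g.
by move=> s5 s6; nia.
Qed.

(** The point is picked from the hits alone, which flips within [A] preserve; the same point is then
    picked again, which makes [flip] an involution. *)
Let flip (p : 'S_n) : 'S_n :=
  if [pick i in A | hit i p] is Some i then (tperm i (rho i) * p)%g else p.

Let hit_flip i j p : i \in A -> j \in A ->
  hit j (tperm i (rho i) * p)%g = hit j p.
Proof.
move=> iA jA; rewrite /hit !(permM (tperm _ _)).
have [->|ij] := eqVneq j i; first by rewrite tpermL tpermR orbC.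
by rewrite !tpermD // ?(inj_eq perm_inj) ?rho_neq // eq_sym ?rho_neq.
Qed.

Let pick_flip p : [pick i in A | hit i (flip p)] = [pick i in A | hit i p].
Proof.
apply: eq_pick => j /=; case: (boolP (j \in A)) => //= jA.
by rewrite /flip; case: pickP => // i /andP[iA _]; rewrite hit_flip.
Qed.

Let flipK : involutive flip.
Proof.
move=> p; rewrite {1}/flip pick_flip /flip; case: pickP => // i _.
by rewrite mulgA tperm2 mul1g.
Qed.

(** [flip] injects the balanced hitters into the unbalanced guesses; the other hitters are
    unbalanced already. *)
Lemma hitters_unbalanced : (#|hitters| <= 2 * #|~: balanced s s'|)%N.
Proof.
rewrite -(cardsID (balanced s s') hitters) mul2n -addnn leq_add //; last first.
  by apply/subset_leq_card/subsetP => p; rewrite !inE => /andP[].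
rewrite -(card_imset _ (inv_inj flipK)).
apply/subset_leq_card/subsetP => _ /imsetP[p + ->]; rewrite in_setI in_setC => /andP[]; rewrite inE => /existsP[j hj] pb.
rewrite /flip; case: pickP => [i /andP[iA hi]|/(_ j)]; last by rewrite hj.
exact: flip_unbalanced (subsetP AD _ iA) hi pb.
Qed.
End Independent.

(** The 6 is a factor 3 lost in choosing [A] times a factor 2 lost in the flip. *)
Lemma card_unbalanced :
  (#|diffset s s'| * n`! <= 6 * n * #|~: balanced s s'|)%N.
Proof.
have [A [AD Adis DA An]] := indep_exists.
have h1 := card_hitters AD Adis An.
have h2 := hitters_unbalanced AD Adis.
apply: leq_trans (leq_mul DA (leqnn _)) _; rewrite -mulnA.
apply: leq_trans (leq_mul (leqnn 3) h1) _.
by apply: leq_trans (leq_mul (leqnn 3) (leq_mul (leqnn n) h2)) _; lia.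
Qed.
End Separation.

(** * Separating families *)

Section UnionBound.
Variable n : nat.

Local Notation cell := (option ('I_n * 'I_n)).

(** A common value adds the same to both scores, so it is forgotten. *)
Definition key (s s' : 'S_n) : {ffun 'I_n -> cell} :=
  [ffun i => if s i == s' i then None else Some (s i, s' i)].

Definition balanced_key (h : {ffun 'I_n -> cell}) : {set 'S_n} :=
  [set p : 'S_n | \sum_i (if h i is Some (a, _) then p i == a else false)
           == \sum_i (if h i is Some (_, b) then p i == b else false)]%N.

Lemma black_sum (p s : 'S_n) : black p s = (\sum_i (p i == s i))%N.
Proof.
by rewrite /black -sum1_card big_mkcond; apply: eq_bigr => i _; rewrite inE; case: ifP.
Qed.

Lemma balanced_keyE (s s' : 'S_n) : balanced s s' = balanced_key (key s s').
Proof.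
apply/setP=> p; rewrite !inE !black_sum.
pose c := (\sum_i ((s i == s' i) && (p i == s i)))%N.
rewrite -[RHS](eqn_add2l c) -!big_split /=.
congr (_ == _); apply: eq_bigr => i _; rewrite ffunE.
all: by case: (s i =P s' i) => [->|_] /=; rewrite ?addn0 ?add0n.
Qed.

Lemma key_eqNone (s s' : 'S_n) : (key s s' == [ffun=> None]) = (s == s').
Proof.
apply/eqP/eqP => [/ffunP e|->]; last by apply/ffunP=> i; rewrite !ffunE eqxx.
by apply/permP=> i; have := e i; rewrite !ffunE; case: eqP.
Qed.

Local Open Scope ring_scope.

(** Expanding the product over positions, each contributes 1 for [None] and [x] for each of the
    [n ^ 2] cells. *)
Lemma sum_exp_support (F : comNzRingType) (x : F) :
  \sum_(h : {ffun 'I_n -> cell}) x ^+ #|[set i | h i]| = (1 + (n ^ 2)%:R * x) ^+ n.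
Proof.
pose w (o : cell) := if o then x else 1.
have -> : (1 + (n ^ 2)%:R * x) ^+ n = \prod_(i < n) \sum_o w o.
  rewrite prodr_const card_ord (bigD1 None) //=; congr ((_ + _) ^+ _).
  rewrite (eq_bigr (fun=> x)); last by case.
  rewrite sumr_const cardC1 card_option card_prod card_ord /=.
  by rewrite mulr_natl mulnn.
rewrite bigA_distr_bigA; apply: eq_bigr => h _.
rewrite (bigID (fun i : 'I_n => isSome (h i))) /= [X in _ * X]big1 ?mulr1; last first.
  by move=> i; rewrite /w => /negbTE ->.
rewrite (eq_bigr (fun=> x)); last by move=> i; rewrite /w => ->.
by rewrite prodr_const; congr (_ ^+ _); apply: eq_card => i; rewrite inE.
Qed.

Variable F : realFieldType.

Lemma exp1D_lt2 (y : F) (m : nat) : 0 <= y -> 2 * m%:R * y < 1 -> (1 + y) ^+ m < 2.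
Proof.
move=> y0 my; suff h : (1 + y) ^+ m <= 1 + 2 * m%:R * y by lra.
elim: m my => [|m IHm]; first by rewrite expr0; lra.
rewrite -natr1 exprSr => my; have m0 : 0 <= m%:R :> F by [].
have my1 : 2 * m%:R * y < 1 by nra.
apply: le_trans (ler_wpM2r _ (IHm my1)) _; first by lra.
by nra.
Qed.

(* A guess leaves a pair balanced or not according to its key only, so the union
   bound runs over keys, of which those of distance [d] number at most
   [binomial n d * n ^ (2 * d)]; over the pairs it would be too lossy. *)
Lemma separating_family (T : nat) (x : F) : (0 < n)%N -> 0 <= x ->
  (forall d, (d <= n)%N -> (1 - d%:R / (6 * n)%:R) ^+ T <= x ^+ d) ->
  2 * n%:R ^+ 3 * x < 1 ->
  exists f : {ffun 'I_T -> 'S_n}, forall s s',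
    (forall t, black (f t) s = black (f t) s') -> s = s'.
Proof.
move=> n0 x0 xd x1.
pose sep (f : {ffun 'I_T -> 'S_n}) :=
  [forall u : 'S_n * 'S_n, (u.1 != u.2) ==> [exists t, f t \notin balanced u.1 u.2]].
have [f /forallP fP|none] := pickP sep.
  exists f => s s' e; apply/eqP; have := fP (s, s') => /=; apply: contraLR => ss'.
  by rewrite ss' negb_exists; apply/forallP=> t; rewrite !inE e eqxx.
pose K := [set key u.1 u.2 | u : 'S_n * 'S_n & u.1 != u.2].
(* When no list separates, each list consists of balanced guesses for some key in [K]. *)
have cover (f : {ffun 'I_T -> 'S_n}) :
    (1 <= \sum_(h in K) (f \in ffun_on (mem (balanced_key h))))%N.
  have /negbT := none f; rewrite negb_forall => /existsP[u].
  rewrite negb_imply negb_exists => /andP[u12 /forallP ub].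
  rewrite (bigD1 (key u.1 u.2)) /=; last by apply/imsetP; exists u; rewrite ?inE.
  suff -> : f \in ffun_on (mem (balanced_key (key u.1 u.2))) by [].
  by apply/ffun_onP=> t; have := ub t; rewrite -balanced_keyE negbK.
have total : (n`! ^ T <= \sum_(h in K) #|balanced_key h| ^ T)%N.
  have -> : (n`! ^ T = \sum_(f : {ffun 'I_T -> 'S_n}) 1)%N.
    by rewrite sum1_card card_ffun card_ord card_Sn.
  apply: leq_trans (leq_sum _ (fun f _ => cover f)) _.
  rewrite exchange_big leq_sum // => h _.
  rewrite -[T in (_ ^ T)%N]card_ord -card_ffun_on -sum1_card [leqRHS]big_mkcond.
  by rewrite leq_sum // => f _; case: ifP.
have nf0 : 0 < n`!%:R :> F by rewrite ltr0n fact_gt0.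
have bal h : h \in K -> #|balanced_key h|%:R / n`!%:R <= 1 - #|[set i | h i]|%:R / (6 * n)%:R :> F.
  move=> /imsetP[u _ ->]; rewrite -balanced_keyE.
  have -> : [set i | key u.1 u.2 i] = diffset u.1 u.2.
    by apply/setP=> i; rewrite !inE ffunE; case: eqP.
  have dN : #|diffset u.1 u.2|%:R * n`!%:R <= (6 * n)%:R * #|~: balanced u.1 u.2|%:R :> F.
    by rewrite -!natrM ler_nat card_unbalanced.
  have bc : #|balanced u.1 u.2|%:R + #|~: balanced u.1 u.2|%:R = n`!%:R :> F.
    by rewrite -natrD cardsC card_Sn.
  have M0 : 0 < (6 * n)%:R :> F by rewrite ltr0n muln_gt0.
  rewrite ler_pdivrMr // mulrBl mul1r lerBrDr -bc lerD2l mulrAC.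
  by rewrite ler_pdivrMr // bc [leRHS]mulrC.
have sumK : 1 <= \sum_(h in K) x ^+ #|[set i | h i]|.
  have pw0 : 0 < n`!%:R ^+ T :> F by rewrite exprn_gt0.
  rewrite -(ler_pM2r pw0) mul1r; move: total; rewrite -(ler_nat F) natrX => /le_trans; apply.
  rewrite natr_sum mulr_suml ler_sum // => h hK; rewrite natrX.
  have d_n : (#|[set i | h i]| <= n)%N by rewrite -[leqRHS]card_ord max_card.
  apply: le_trans (ler_wpM2r (ltW pw0) (xd _ d_n)); rewrite -exprMn.
  apply: lerXn2r; rewrite ?nnegrE ?ler0n //; last by rewrite -ler_pdivrMr // bal.
  by rewrite mulr_ge0 ?ler0n // (le_trans _ (bal _ hK)) // divr_ge0.
(* The extra 1 is the term of the empty key, which is not in [K]; with [sumK] it forces the right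
   side to be at least 2. *)
have sumA : 1 + \sum_(h in K) x ^+ #|[set i | h i]| <= (1 + (n ^ 2)%:R * x) ^+ n.
  rewrite -sum_exp_support [leRHS](bigD1 [ffun=> None]) //=; apply: lerD.
    rewrite (_ : [set _ | _] = set0) ?cards0 //.
    by apply/setP=> i; rewrite !inE ffunE.
  rewrite big_mkcond [leRHS]big_mkcond ler_sum //= => h _.
  case: ifPn => [/imsetP[u + ->]|_]; last by case: ifP => // _; apply: exprn_ge0.
  by rewrite inE key_eqNone => ->.
have : (1 + (n ^ 2)%:R * x) ^+ n < 2.
  apply: exp1D_lt2; first by rewrite mulr_ge0.
  by apply: le_lt_trans x1; rewrite natrX; lra.
by lra.
Qed.
End UnionBound.

(** * Local walks *)

Lemma diffset_ex n (p q : 'S_n) : p != q -> exists x, x \in diffset p q.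
Proof. by move=> pq; apply/set0Pn; apply: contra pq => /eqP /diffset0_eq ->. Qed.

Lemma mem_diffset_swap n (p q : 'S_n) x : x \in diffset p q ->
  let y := (p^-1)%g (q x) in y != x /\ y \in diffset p q.
Proof.
move=> xD y; have py : p y = q x by rewrite permKV.
have yx : y != x by apply: contraL xD => /eqP e; rewrite inE -py e eqxx.
by split=> //; rewrite inE py (inj_eq perm_inj) eq_sym.
Qed.

(* [x] is the next position to correct; it is charged in advance, so that
   walking along a cycle costs one new position per correction. *)
Lemma partial_correction n (p q : 'S_n) j : (j <= #|diffset p q|)%N ->
  exists r : 'S_n, [/\ r != q -> exists2 x, x \in diffset r q &
      (#|x |: diffset p r| + #|diffset r q| <= #|diffset p q|.+1)%N,
    (#|diffset p r| <= j.+1)%N & (#|diffset r q| + j <= #|diffset p q|)%N].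
Proof.
elim: j => [|j IHj] jd.
  exists p; have dpp : diffset p p = set0 by apply/setP=> i; rewrite !inE eqxx.
  rewrite dpp cards0 addn0; split=> // /diffset_ex[x xD].
  by exists x => //; rewrite setU0 cards1.
have [r [hole pr rq]] := IHj (ltnW jd).
have [lt|ge] := ltnP (#|diffset r q| + j) #|diffset p q|.
  by exists r; split; rewrite // ?addnS // leqW.
have [x xD xc] : exists2 x, x \in diffset r q &
    (#|x |: diffset p r| + #|diffset r q| <= #|diffset p q|.+1)%N.
  apply: hole; apply: contraTneq jd => e; move: ge; rewrite e.
  rewrite (_ : diffset q q = set0) ?cards0 -?leqNgt //.
  by apply/setP=> i; rewrite !inE eqxx.
have := mem_diffset_swap xD; set y := (r^-1)%g (q x) => -[yx yD].
pose r' : 'S_n := (tperm x y * r)%g.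
have r'x : r' x = q x by rewrite permM tpermL permKV.
have r'D i : i != x -> i != y -> r' i = r i.
  by move=> ix iy; rewrite permM tpermD // eq_sym.
have pr' : diffset p r' \subset y |: (x |: diffset p r).
  apply/subsetP=> i; rewrite !inE; case: (eqVneq i y) => //= iy.
  by case: (eqVneq i x) => //= ix; rewrite r'D.
have r'q : diffset r' q \subset diffset r q :\ x.
  apply/subsetP=> i; rewrite !inE; case: (eqVneq i x) => [->|ix] /=.
    by rewrite r'x eqxx.
  case: (eqVneq i y) => [-> _|iy]; last by rewrite r'D.
  by move: yD; rewrite inE.
have c1 := cardsD1 x (diffset r q); rewrite xD add1n in c1.
have c2 := subset_leq_card r'q.
have c3 := subset_leq_card pr'.
have c4 (i : 'I_n) (B : {set 'I_n}) : (#|i |: B| <= #|B|.+1)%N by rewrite cardsU1; case: (i \notin B).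
have c5 := c4 y (x |: diffset p r).
have pr'j : (#|diffset p r'| <= j.+2)%N by rewrite (leq_trans c3) // (leq_trans c5) //; lia.
have r'qj : (#|diffset r' q| + j.+1 <= #|diffset p q|)%N by lia.
exists r'; split=> // r'nq.
(* If [y] is still wrong, it is the next position on the cycle. Otherwise the cycle has closed and
   the swap corrected two positions, which pays for opening a new cycle at [z]. *)
have [yD'|yD'] := boolP (y \in diffset r' q).
  exists y => //; apply: leq_trans xc; rewrite c1 addnS -addSn leq_add //.
  apply: leq_trans c5; by rewrite subset_leq_card // subUset pr' andbT sub1set !inE eqxx.
have [z zD] := diffset_ex r'nq; exists z => //.
apply: leq_trans xc; rewrite c1 addnS -addSn.
apply: (@leq_trans (#|x |: diffset p r|.+2 + #|diffset r' q|)).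
  by rewrite leq_add2r (leq_trans (c4 _ _)) // ltnS (leq_trans c3).
rewrite addSnnS leq_add2l; apply/proper_card/properP; split=> //; exists y => //.
by rewrite !inE yx; move: yD; rewrite inE.
Qed.

(** Each step corrects [k.-1] positions, or all that remain. The successor in the bound is free,
    because two permutations never differ at exactly one position. *)
Lemma local_path n k m (p q : 'S_n) : (1 < k)%N ->
  (#|diffset p q| <= (m * k.-1).+1)%N ->
  exists w, [/\ path (@local_step n k) p w, last p w = q & (size w <= m)%N].
Proof.
move=> k1; elim: m p => [|m IHm] p D.
  exists [::]; split=> //=; apply/eqP; apply: contraLR D => /diffset_ex[x xD].
  have [yx yD] := mem_diffset_swap xD.
  rewrite mul0n -ltnNge (cardD1 x) (cardD1 ((p^-1)%g (q x))) xD !inE yx.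
  by move: yD; rewrite inE => ->.
have [r [_ pr rq]] := partial_correction (geq_minr k.-1 #|diffset p q|).
have [|w [pw lw sw]] := IHm r.
  by move: rq D; rewrite mulSn; move: #|_| #|_| (m * _)%N => a b c; lia.
exists (r :: w); split=> //=; rewrite pw andbT.
by rewrite /local_step (leq_trans pr) // -[leqRHS](ltn_predK k1) ltnS geq_minl.
Qed.

Lemma local_walk n k m (p : 'S_n) (s : seq 'S_n) : (1 < k)%N ->
  (n <= (m * k.-1).+1)%N ->
  exists w, [/\ path (@local_step n k) p w, {subset s <= p :: w}
    & (size w <= size s * m)%N].
Proof.
move=> k1 nm; elim: s p => [|q s IHs] p; first by exists [::].
have [||w1 [pw1 lw1 sw1]] := @local_path n k m p q => //.
  by rewrite (leq_trans _ nm) // -[leqRHS]card_ord max_card.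
have [w2 [pw2 sub2 sw2]] := IHs q.
exists (w1 ++ w2); split; last by rewrite size_cat mulSn leq_add.
  by rewrite cat_path pw1 lw1.
move=> y; rewrite inE => /predU1P[->|/sub2].
  by rewrite -cat_cons mem_cat -lw1 mem_last.
by rewrite -cat_cons mem_cat inE => /predU1P[->|->]; rewrite ?orbT // -lw1 mem_last.
Qed.

(** * From separating guesses to local strategies *)

Lemma correct_static_inj n (g : seq 'S_n) :
  injective (fun s => [seq black p s | p <- g]) -> correct_static g.
Proof.
move=> ginj; exists (fun v => odflt 1%g [pick s | [seq black p s | p <- g] == v]) => s.
by case: pickP => [s' /eqP /ginj //|/(_ s)]; rewrite eqxx.
Qed.

Lemma local_static_upper n k T m (f : {ffun 'I_T -> 'S_n}) :
  (forall s s', (forall t, black (f t) s = black (f t) s') -> s = s') ->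
  (1 < k)%N -> (0 < T)%N -> (0 < m)%N -> (n <= (m * k.-1).+1)%N ->
  exists2 S, local_static_length n k S & (S <= T * m)%N.
Proof.
move=> fsep k1 T0 m0 nm; have := size_codom f; rewrite card_ord.
case E: (codom f) => [|p s] sT; first by move: T0; rewrite -sT.
have [w [pw sub sw]] := local_walk p s k1 nm.
(* Starting at the first guess leaves [T - 1] walks, and [1 + (T - 1) * m <= T * m] as [m] is
   positive. *)
exists (size (p :: w)); last by rewrite -sT /= mulSn; lia.
exists (p :: w); split=> //; apply: correct_static_inj => s1 s2 /eq_in_map e.
apply: fsep => t; apply: e; have := codom_f f t; rewrite E inE.
by case/predU1P=> [->|/sub //]; rewrite mem_head.
Qed.

(** * Covered cells *)

Definition covered n (g : seq 'S_n) : {set 'I_n * 'I_n} :=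
  [set u | has (fun p : 'S_n => p u.1 == u.2) g].

(** A cell of [p] that [q] does not cover lies in a row of [diffset p q], so prepending [p] adds at
    most [k] cells. *)
Lemma card_covered n k (p : 'S_n) w : path (@local_step n k) p w ->
  (#|covered (p :: w)| <= n + k * size w)%N.
Proof.
elim: w p => [|q w IHw] p /=.
  move=> _; rewrite muln0 addn0 -[leqRHS]card_ord.
  rewrite -(card_imset _ (_ : injective (fun i => (i, p i)))); last by move=> i j [].
  apply/subset_leq_card/subsetP=> -[i a]; rewrite inE /= orbF => /eqP <-.
  by apply/imsetP; exists i.
case/andP=> pq /IHw cov; rewrite mulnS addnCA.
apply: leq_trans (leq_add pq cov).
rewrite -(card_imset _ (_ : injective (fun i => (i, p i)))); last by move=> i j [].
apply: leq_trans (leq_card_setU _ _).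
apply/subset_leq_card/subsetP=> -[i a]; rewrite !inE /= orbA.
case: (eqVneq (q i) a) => [<-|qia] /=; first by rewrite !orbT.
rewrite orbF; case/orP=> [/eqP pia|->]; last by rewrite orbT.
by rewrite -pia imset_f // inE pia eq_sym.
Qed.

(* Two secrets differing by a swap whose four cells are all uncovered receive the
   same scores. *)
Lemma uncovered_C4free n (g : seq 'S_n) i j a b : correct_static g ->
  i != j -> a != b -> (i, a) \notin covered g -> (i, b) \notin covered g ->
  (j, a) \notin covered g -> (j, b) \in covered g.
Proof.
move=> [final finalP] ij ab ia ib ja; apply/negPn/negP => jb.
(* The first factor sends [i] to [a]; the second sends the image of [j] to [b] and fixes [a]. *)
pose s : 'S_n := (tperm i a * tperm (tperm i a j) b)%g.
have si : s i = a.
  rewrite permM tpermL; apply: tpermD; last by rewrite eq_sym.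
  by rewrite -[X in _ != X](tpermL i a) (inj_eq perm_inj) eq_sym.
have sj : s j = b by rewrite permM tpermL.
pose s' : 'S_n := (tperm i j * s)%g.
have s's : s' = s.
  rewrite -(finalP s) -(finalP s'); congr final; apply/eq_in_map=> p pg.
  have nc l c : (l, c) \notin covered g -> p l == c = false.
    by rewrite inE => /hasPn /(_ _ pg) /= /negbTE.
  rewrite /black; apply: eq_card => l; rewrite !inE permM.
  by case: tpermP => [->|->|//]; rewrite ?si ?sj ?nc.
have : s' i = s i by rewrite s's.
by rewrite permM tpermL si sj => e; move: ab; rewrite e eqxx.
Qed.

(** The left side counts pairs of rows meeting [U] in a common column: equal rows give [#|U|], and
    distinct rows share at most one column. *)
Lemma C4free_sum_sqr n (U : {set 'I_n * 'I_n}) :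
  (forall i j a b, i != j -> a != b -> (i, a) \in U -> (i, b) \in U ->
     (j, a) \in U -> (j, b) \notin U) ->
  (\sum_a (\sum_i ((i, a) \in U)) * (\sum_i ((i, a) \in U)) <= #|U| + n * n)%N.
Proof.
move=> free; under eq_bigr do rewrite big_distrlr /=.
rewrite exchange_big /=.
have -> : (#|U| + n * n = \sum_(i < n) (\sum_a ((i, a) \in U) + n))%N.
  rewrite big_split /= sum_nat_const card_ord; congr (_ + _)%N.
  rewrite pair_bigA /= -sum1_card big_mkcond.
  by apply: eq_bigr => -[i a] _ /=; case: ifP.
apply: leq_sum => i _; rewrite exchange_big /= (bigD1 i) //= leq_add //.
  by apply: leq_sum => a _; case: (_ \in _).
apply: (@leq_trans (\sum_(j | j != i) 1)%N); last first.
  by rewrite sum1_card -[leqRHS]card_ord max_card.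
apply: leq_sum => j ji; rewrite leqNgt; apply/negP=> two.
have : (1 < #|[set a | ((i, a) \in U) && ((j, a) \in U)]|)%N.
  rewrite -sum1_card big_mkcond /=; apply: leq_trans two _.
  by apply: leq_sum => a _; rewrite inE mulnb; case: andb.
case/card_gt1P=> a [b []]; rewrite !inE => /andP[ia ja] /andP[ib jb] ab.
by have := free i j a b; rewrite eq_sym ji ab ia ib ja jb => /(_ isT isT isT isT isT).
Qed.

Local Open Scope ring_scope.

(* The case [s = 2] of the Kovari-Sos-Turan theorem; instead of Cauchy-Schwarz,
   the column degrees are compared with their expected value [sqrt n + 1/2]. *)
Lemma C4free_card (R : rcfType) n (U : {set 'I_n * 'I_n}) : (0 < n)%N ->
  (forall i j a b, i != j -> a != b -> (i, a) \in U -> (i, b) \in U ->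
     (j, a) \in U -> (j, b) \notin U) ->
  #|U|%:R <= n%:R * Num.sqrt n%:R + n%:R :> R.
Proof.
move=> n0 free; pose deg a := (\sum_i ((i, a) \in U))%N.
have sum_deg : (\sum_a deg a = #|U|)%N.
  rewrite exchange_big pair_bigA /= -sum1_card [RHS]big_mkcond.
  by apply: eq_bigr => -[i a] _ /=; case: ifP.
have sqr_deg : \sum_a (deg a)%:R ^+ 2 <= #|U|%:R + n%:R ^+ 2 :> R.
  rewrite expr2 -natrM -natrD; under eq_bigr do rewrite expr2 -natrM.
  by rewrite -natr_sum ler_nat (C4free_sum_sqr free).
pose r : R := Num.sqrt n%:R.
have rE : r ^+ 2 = n%:R by rewrite sqr_sqrtr.
have r1 : 1 <= r by rewrite -[leLHS]sqrtr1 ler_sqrt ?ler1n ?ltr0n.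
(* The added half absorbs the [#|U|] in [sqr_deg]: the coefficient left is [2 * t - 1 = 2 * r]. *)
pose t := r + 2^-1.
have : 0 <= \sum_a ((deg a)%:R - t) ^+ 2 by apply: sumr_ge0 => a _; apply: sqr_ge0.
under eq_bigr do rewrite sqrrB.
rewrite big_split sumrB /= sumr_const card_ord sumrMnl -mulr_suml -natr_sum sum_deg.
rewrite -[t ^+ 2 *+ n]mulr_natl -/r -rE; rewrite -rE in sqr_deg.
move: sqr_deg; set q := \sum_a _; move: #|U|%:R q => u q qu q0.
have ur : u * (2 * r) <= 2 * r ^+ 4 + r ^+ 3 + r ^+ 2 / 4.
  by move: q0; rewrite /t => q0; nra.
have r2 : 0 < 2 * r by lra.
by rewrite -(ler_pM2r r2); apply: (le_trans ur); nra.
Qed.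

Lemma local_static_lower (R : rcfType) n k (g : seq 'S_n) : (0 < n)%N ->
  ell_local k g -> correct_static g ->
  n%:R ^+ 2 - (n%:R * Num.sqrt n%:R + 2 * n%:R) <= k%:R * (size g)%:R :> R.
Proof.
move=> n0 gl gc.
have free (i j a b : 'I_n) : i != j -> a != b -> (i, a) \in ~: covered g ->
    (i, b) \in ~: covered g -> (j, a) \in ~: covered g -> (j, b) \notin ~: covered g.
  by rewrite !in_setC negbK; apply: uncovered_C4free.
have := C4free_card R n0 free.
have cov : (#|covered g| <= n + k * size g)%N.
  case: g gl {gc free} => [_|p w /card_covered /leq_trans]; last first.
    by apply; rewrite /= mulnS; lia.
  by rewrite (_ : covered _ = set0) ?cards0 //; apply/setP=> u; rewrite !inE.
have := cardsC (covered g); rewrite card_prod card_ord => /(congr1 (GRing.natmul (1 : R))).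
move: cov; rewrite -(ler_nat R) !natrD !natrM expr2; lra.
Qed.

(** * Number of random guesses *)

(* Imported only here, as [classical_sets] shadows the [finset] operations. *)
From mathcomp Require Import boolp classical_sets reals topology normedtype sequences exp.
Import numFieldNormedType.Exports.

Lemma half_le_ln2 (R : realType) : 2^-1 <= ln 2 :> R.
Proof.
have h : (2^-1 : R) = 1 + - 2^-1 by lra.
by have := @le_ln1Dx R (- 2^-1) ltac:(lra); rewrite -h lnV ?posrE //; lra.
Qed.

Lemma ln2_le1 (R : realType) : ln 2 <= 1 :> R.
Proof. by have := @le_ln1Dx R 1 ltac:(lra). Qed.

Lemma separating_guesses (R : realType) n : (2 <= n)%N ->
  exists T (f : {ffun 'I_T -> 'S_n}), [/\ (0 < T)%N,
    T%:R <= 28 * n%:R * log2 (n%:R : R) &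
    forall s s', (forall t, black (f t) s = black (f t) s') -> s = s'].
Proof.
move=> n2; have n0 : (0 < n)%N := ltnW n2.
have nR : 2 <= n%:R :> R by rewrite ler_nat.
have ln2h := half_le_ln2 R; have ln21 := ln2_le1 R.
have lnn : ln 2 <= ln (n%:R : R) by rewrite ler_ln ?posrE //; lra.
have logn : ln n%:R <= log2 (n%:R : R).
  by rewrite /log2 ler_pdivlMr; [rewrite ler_piMr|]; lra.
set B := 28 * n%:R * log2 n%:R.
have B1 : 28 * n%:R * ln n%:R <= B by rewrite ler_pM2l //; lra.
have B0 : 0 <= B by apply: le_trans B1; apply: mulr_ge0; lra.
pose T := Num.truncn B.
have /andP[TB BT] := truncn_itv B0; rewrite -/T -natr1 in TB BT.
have nl : 1 <= n%:R * ln (n%:R : R) by nra.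
have M0 : 0 < (6 * n)%:R :> R by rewrite ltr0n muln_gt0.
(* With this [x], the bound [1 - u <= expR (- u)] at [u = d / (6 n)], raised to the power [T], gives
   [x ^+ d]. *)
pose x : R := expR (- (T%:R / (6 * n)%:R)).
have [|d dn||f fsep] := @separating_family n R T x n0.
- exact: expR_ge0.
- have dn0 : d%:R / (6 * n)%:R <= 1 :> R.
    by rewrite ler_pdivrMr // mul1r ler_nat; lia.
  rewrite /x -expRM_natl.
  apply: (@le_trans _ _ (expR (- (d%:R / (6 * n)%:R)) ^+ T)).
    apply: lerXn2r; rewrite ?nnegrE ?subr_ge0 // ?expR_ge0 //.
    exact: expR_ge1Dx.
  rewrite -expRM_natl ler_expR.
  by rewrite !mulrN mulrCA.
- have n3 : 2 * n%:R ^+ 3 = expR (ln 2 + 3%:R * ln n%:R) :> R.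
    by rewrite expRD expRM_natl !lnK ?posrE //; lra.
  (* As [ln 2 + 3 ln n <= 4 ln n], it suffices that [T] exceed [24 n ln n]; the constant 28 leaves
     room for the rounding of [T], by [nl]. *)
  rewrite n3 -expRD -[ltRHS]expR0 ltr_expR subr_lt0 ltr_pdivlMr // natrM.
  nra.
exists T, f; split=> //; rewrite -(ltr_nat R); nra.
Qed.

(** * The two bounds on [S_ell] *)

Local Open Scope classical_set_scope.

Theorem theorem2 (R : realType) :
  exists eps : nat -> R,
    eps n @[n --> \oo] --> (0 : R) /\
    forall (k : nat) (k_gt1 : (1 < k)%N) (n : nat), (2 <= n)%N ->
      (n%:R ^+ 2 - (1 + eps n) * n%:R `^ (3 / 2)) / k%:R
        <= (S_ell n k_gt1)%:R :> R
      /\ (S_ell n k_gt1)%:R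
        <= 28 * n%:R * log2 (n%:R : R)
           * (Num.ceil ((n%:R - 1) / (k%:R - 1) : R))%:~R.
Proof.
(* This choice turns the linear term [2 n] of [local_static_lower] into [eps n] times [n] to the
   power [3 / 2]. *)
exists (fun n => 2 / Num.sqrt n%:R); split.
  apply/cvgrPdist_lt => e e0; near=> n.
  have n0 : (2 / e) ^+ 2 < n%:R by near: n; apply: nbhs_infty_gtr.
  have e2 : 0 <= 2 / e by rewrite divr_ge0 // ltW.
  have lt : 2 / e < Num.sqrt n%:R.
    by rewrite -[ltLHS]ger0_norm // -sqrtr_sqr ltr_sqrt // (le_lt_trans _ n0) ?sqr_ge0.
  have s0 : 0 < Num.sqrt n%:R :> R by apply: le_lt_trans lt.
  rewrite sub0r normrN ger0_norm ?divr_ge0 ?(ltW s0) //.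
  by rewrite ltr_pdivrMr // mulrC -ltr_pdivrMr.
move=> k k1 n n2; have n0 : (0 < n)%N := ltnW n2.
have nR : 0 < n%:R :> R by rewrite ltr0n.
have kR : 1 < k%:R :> R by rewrite ltr1n.
split.
  rewrite ler_pdivrMr; last by lra.
  rewrite [leRHS]mulrC /S_ell; case: ex_minnP => S /asboolP[g [<- gl gc]] _.
  apply: le_trans (local_static_lower R n0 gl gc).
  have -> : n%:R `^ (3 / 2) = n%:R * Num.sqrt n%:R :> R.
    rewrite (_ : 3 / 2 = 1 + 2^-1); last by lra.
    by rewrite powRD ?powRr1 ?powR12_sqrt ?(gt_eqF nR) ?implybT ?ler0n.
  have s0 : Num.sqrt n%:R != 0 :> R by rewrite gt_eqF // sqrtr_gt0.
  by rewrite le_eqVlt; apply/orP; left; apply/eqP; field.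
have [T [f [T0 TB fsep]]] := separating_guesses R n2.
set y := (n%:R - 1) / (k%:R - 1).
have y0 : 0 < y by rewrite divr_gt0 // subr_gt0 // ltr1n.
have c0 : 0 < Num.ceil y by rewrite ceil_gt0.
have mE : (Num.ceil y)%:~R = `|Num.ceil y|%N%:R :> R.
  by rewrite natr_absz gtr0_norm.
set m := `|_|%N in mE.
have nm : (n <= (m * k.-1).+1)%N.
  have := ceil_ge y; rewrite mE ler_pdivrMr ?subr_gt0 //.
  rewrite -(ler_nat R) -natr1 natrM -subn1 natrB ?(ltnW k1) //; lra.
rewrite mE; have m0 : (0 < m)%N by rewrite absz_gt0 gt_eqF.
apply: le_trans (ler_wpM2r (ler0n R m) TB).
rewrite -natrM ler_nat /S_ell; case: ex_minnP => S _ Smin.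
have [S' /asboolP/Smin/leq_trans] := local_static_upper fsep k1 T0 m0 nm.
exact.
Unshelve. all: by end_near.
Qed.
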